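(* Let $p=p(x)$, $q=q(x)$ be the two distinct roots of $z^2=\sigma z+t$, where $\sigma=\sigma(x)$ and $t=t(x)$ are functions with values in a field of characteristic zero, so that $p+q=\sigma$ and $p\cdot q=-t$; assume $p(x)\neq 0\neq q(x)$ and that $p(x)/q(x)$ is not a root of unity for every $x$. Put $$U_n=\frac{p^n-q^n}{p-q},\qquad V_n=p^n+q^n\qquad(n\ge 0).$$ Then, for all positive integers $r,s$, the recurrence $$V_{r+s}=U_{s+1}\cdot V_r+t\cdot V_{r-1}\cdot U_s$$ is equivalent to $$\binom{r+s}{r,s}_{\langle .\rangle/\{.\}}=U_{s+1}\cdot\binom{r+s-1}{r-1,s}_{\langle .\rangle/\{.\}}+t\cdot V_{r-1}\cdot\binom{r+s-1}{r,s-1}_{\langle .\rangle/\{.\}},$$ where $\binom{r+s}{r,s}_{\langle .\rangle/\{.\}}$ denotes the $V$-mixed-$U$ binomial coefficient.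
   Context: The sequence $U=\langle U_n\rangle$ is the fundamental Lucas sequence ($U_0=0$, $U_1=1$) and $V=\langle V_n\rangle$ is the primordial Lucas sequence ($V_0=2$, $V_1=p+q=\sigma$). Factorials are $U_n!=U_nU_{n-1}\cdots U_1$ and $V_n!=V_nV_{n-1}\cdots V_1$, with $U_0!=V_0!=1$ (empty products). For nonnegative integers $r,s$ the $V$-mixed-$U$ binomial coefficient is $$\binom{r+s}{r,s}_{\langle .\rangle/\{.\}}=\frac{V_{r+s}!}{V_r!\cdot U_s!}.$$ It is in general not symmetric in $r$ and $s$. *)

(* Defs.v *)
From mathcomp Require Import all_boot all_order all_algebra.

Set Implicit Arguments.
Unset Strict Implicit.
Unset Printing Implicit Defensive.

Import GRing.Theory.
Local Open Scope ring_scope.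

Definition lucasU (F : fieldType) (p q : F) (n : nat) : F :=
  (p ^+ n - q ^+ n) / (p - q).

Definition lucasV (F : fieldType) (p q : F) (n : nat) : F :=
  p ^+ n + q ^+ n.

(* W_n! = W_n W_(n-1) ... W_1; the value W_0 is not a factor, and W_0! = 1. *)
Definition seq_fact (F : fieldType) (W : nat -> F) (n : nat) : F :=
  \prod_(1 <= i < n.+1) W i.

(* The V-mixed-U binomial coefficient with upper entry r + s and lower entries
   r, s: r indexes the V-factorial and s the U-factorial, so the order of the
   two arguments matters. *)
Definition mixed_binom (F : fieldType) (p q : F) (r s : nat) : F :=
  seq_fact (lucasV p q) (r + s) /
    (seq_fact (lucasV p q) r * seq_fact (lucasU p q) s).

(* z is a root of unity; exponent 0 must be excluded, since every z satisfies
   0.-unity_root z. *)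
Definition is_root_of_unity (F : fieldType) (z : F) : Prop :=
  exists2 n : nat, (0 < n)%N & n.-unity_root z.

Lemma distinct_roots_vieta (F : fieldType) (sigma t p q : F) :
  p ^+ 2 = sigma * p + t -> q ^+ 2 = sigma * q + t -> p != q ->
  p + q = sigma /\ p * q = - t.
Proof.
move=> hp hq pq.
have e : p + q = sigma.
  apply: (@mulIf _ (p - q)); first by rewrite subr_eq0.
  by rewrite mulrC -subr_sqr hp hq mulrBr opprD addrACA subrr addr0.
split=> //; apply/eqP; rewrite -subr_eq0 opprK; apply/eqP.
apply: (@addrI _ (p ^+ 2)).
by rewrite addr0 addrA expr2 -mulrDr e mulrC -hp expr2.
Qed.

(* Main.v *)
Require Import Defs.
From mathcomp Require Import all_boot all_order all_algebra.

Set Implicit Arguments.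
Unset Strict Implicit.
Unset Printing Implicit Defensive.

Import GRing.Theory.
Local Open Scope ring_scope.

(** The two identities are proportional.  Put
    c = V_(r+s-1)! / (V_r! U_s!).  Cancelling one factor of the relevant
    factorial gives
      B r s = c V_(r+s),   B (r-1) s = c V_r,   B r (s-1) = c U_s,
    so the binomial identity is c times the recurrence.  The hypotheses on the
    roots make c nonzero: U_n = 0 means (p/q)^n = 1, and V_n = 0 means
    (p/q)^n = -1, hence (p/q)^(2n) = 1; neither happens for n > 0 when p/q is
    not a root of unity. *)

Lemma seq_factS (F : fieldType) (W : nat -> F) (n : nat) :
  seq_fact W n.+1 = seq_fact W n * W n.+1.
Proof. by rewrite /seq_fact big_nat_recr. Qed.

Lemma seq_fact_neq0 (F : fieldType) (W : nat -> F) (n : nat) :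
  (forall k, (0 < k)%N -> W k != 0) -> seq_fact W n != 0.
Proof.
move=> W_neq0; elim: n => [|n IHn]; first by rewrite /seq_fact big_geq ?oner_eq0.
by rewrite seq_factS mulf_neq0 ?W_neq0.
Qed.

Lemma expf_neq_of_nonunity (F : fieldType) (p q : F) (n : nat) :
  q != 0 -> ~ is_root_of_unity (p / q) -> (0 < n)%N -> p ^+ n != q ^+ n.
Proof.
move=> q_neq0 nonunity n_gt0; apply/eqP => epq; apply: nonunity.
by exists n => //; rewrite unity_rootE expr_div_n epq divff ?expf_neq0.
Qed.

Lemma lucasU_neq0 (F : fieldType) (p q : F) (n : nat) :
  p != q -> q != 0 -> ~ is_root_of_unity (p / q) -> (0 < n)%N ->
  lucasU p q n != 0.
Proof.
move=> pq q_neq0 nonunity n_gt0.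
by rewrite mulf_neq0 ?invr_eq0 ?subr_eq0 ?expf_neq_of_nonunity.
Qed.

Lemma lucasV_neq0 (F : fieldType) (p q : F) (n : nat) :
  q != 0 -> ~ is_root_of_unity (p / q) -> (0 < n)%N -> lucasV p q n != 0.
Proof.
move=> q_neq0 nonunity n_gt0; rewrite addr_eq0; apply/eqP => epq.
have /eqP[] : p ^+ (n * 2) != q ^+ (n * 2).
  by apply: expf_neq_of_nonunity; rewrite // muln_gt0 n_gt0.
by rewrite !exprM epq sqrrN.
Qed.

(** The common factor c, here for r = m + 1 and s = n + 1. *)
Definition mixed_cofactor (F : fieldType) (p q : F) (m n : nat) : F :=
  seq_fact (lucasV p q) (m + n).+1 /
    (seq_fact (lucasV p q) m.+1 * seq_fact (lucasU p q) n.+1).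

Lemma mixed_binomSS (F : fieldType) (p q : F) (m n : nat) :
  mixed_binom p q m.+1 n.+1 =
    mixed_cofactor p q m n * lucasV p q (m.+1 + n.+1).
Proof.
by rewrite /mixed_binom /mixed_cofactor addSn addnS seq_factS mulrAC.
Qed.

Lemma mixed_binom_predl (F : fieldType) (p q : F) (m n : nat) :
  lucasV p q m.+1 != 0 ->
  mixed_binom p q m n.+1 = mixed_cofactor p q m n * lucasV p q m.+1.
Proof.
move=> V_neq0; rewrite /mixed_binom /mixed_cofactor addnS.
by rewrite (seq_factS _ m) (mulrAC _ (lucasV _ _ _)) [in RHS]invfM mulrA divfK.
Qed.

Lemma mixed_binom_predr (F : fieldType) (p q : F) (m n : nat) :
  lucasU p q n.+1 != 0 ->
  mixed_binom p q m.+1 n = mixed_cofactor p q m n * lucasU p q n.+1.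
Proof.
move=> U_neq0; rewrite /mixed_binom /mixed_cofactor addSn.
rewrite (seq_factS _ n) (mulrA (seq_fact _ _)) [in RHS]invfM.
by rewrite (mulrA (seq_fact _ _) _ _^-1) divfK.
Qed.

Theorem mainTheorem2 (F : fieldType) (charF0 : [pchar F] =i pred0)
    (X : Type) (sigma t p q : X -> F)
    (p_root : forall x, p x ^+ 2 = sigma x * p x + t x)
    (q_root : forall x, q x ^+ 2 = sigma x * q x + t x)
    (pq_distinct : forall x, p x != q x)
    (p_neq0 : forall x, p x != 0)
    (q_neq0 : forall x, q x != 0)
    (pq_nonunity : forall x, ~ is_root_of_unity (p x / q x))
    (x : X) (r s : nat) (r_gt0 : (0 < r)%N) (s_gt0 : (0 < s)%N) :
  let U := lucasU (p x) (q x) in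
  let V := lucasV (p x) (q x) in
  let B := mixed_binom (p x) (q x) in
  V (r + s)%N = U s.+1 * V r + t x * V r.-1 * U s
  <->
  B r s = U s.+1 * B r.-1 s + t x * V r.-1 * B r s.-1.
Proof.
case: r r_gt0 => // m _; case: s s_gt0 => // n _ U V B /=.
have U_neq0 k : (0 < k)%N -> U k != 0 by exact: lucasU_neq0.
have V_neq0 k : (0 < k)%N -> V k != 0 by exact: lucasV_neq0.
pose c := mixed_cofactor (p x) (q x) m n.
have c_neq0 : c != 0.
  by rewrite mulf_neq0 ?invr_eq0 ?mulf_neq0 ?seq_fact_neq0.
have -> : B m.+1 n.+1 = c * V (m.+1 + n.+1)%N by exact: mixed_binomSS.
have -> : B m n.+1 = c * V m.+1 by apply: mixed_binom_predl; exact: V_neq0.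
have -> : B m.+1 n = c * U n.+1 by apply: mixed_binom_predr; exact: U_neq0.
rewrite !(mulrCA _ c) -mulrDr.
by split=> [-> | /(mulfI c_neq0)].
Qed.
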